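(* Let $n$ and $j$ be integers such that $0<n\le j$, let $i\in\mathbb{Z}$, and for each odd positive divisor $d\mid n$ let $r_d$ be the remainder of $j$ modulo $d$. Then $$\mathbf{S}^i_n(N(j))= \frac{1}{n}\sum_{\substack{d\mid n,\\ d \text{ odd}}}2^{\lfloor j/d \rfloor}\sum_{0\le s <d} \mathbf{S}^s_d(N(r_d))\, c_d(i-s).$$
   Context: For a non-negative integer $m$, $N(m)=\sum_{S\subseteq \{1,2,\ldots,m\}} x^{\sum S}\in\mathbb{Z}[x]$, where $\sum S$ is the sum of the elements of $S$ (so $N(0)=1$). For $f\in\mathbb{Z}[x]$, a positive integer $d$ and $s\in\mathbb{Z}$, $\mathbf{S}^s_d(f)=\sum_{t\equiv s\pmod d,\ t\ge 0}[x^t]f$, with $[x^t]f$ the coefficient of $x^t$; thus $\mathbf{S}^i_n(N(j))$ is the number of subsets of $\{1,\ldots,j\}$ whose sum is congruent to $i$ modulo $n$. For an integer $l$, the Ramanujan sum is $c_d(l)=\sum_{e\mid d,\ e\mid l}\mu(d/e)\,e$. *)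

(* Defs.v *)
From mathcomp Require Import all_boot all_order all_algebra.

Set Implicit Arguments.
Unset Strict Implicit.
Unset Printing Implicit Defensive.

Import GRing.Theory Num.Theory.

Local Open Scope ring_scope.

(* N(m).  The ordinal k : 'I_m stands for the element k + 1 of {1, ..., m}. *)
Definition subset_sum_poly (m : nat) : {poly int} :=
  \sum_(A : {set 'I_m}) 'X^(\sum_(k in A) k.+1)%N.

(* S^s_d(f).  The coefficients of f vanish from index size f on. *)
Definition coef_sum_mod (d : nat) (s : int) (f : {poly int}) : int :=
  \sum_(t < size f | (t%:Z == s %[mod d])%Z) f`_t.

(* mu(n); only meaningful for n > 0. *)
Definition moebius (n : nat) : int :=
  if has (fun p => p ^ 2 %| n)%N (primes n) then 0
  else (-1) ^+ size (primes n).

Definition ramanujan_sum (d : nat) (l : int) : int :=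
  \sum_(e <- divisors d | (e%:Z %| l)%Z) moebius (d %/ e) * e%:Z.

(* Main.v *)
(* Let w be a primitive n-th root of unity.  By orthogonality,
   n * S^i_n(N(j)) = \sum_(k < n) N(j)(w^k) * w^(- i k).  Group the terms by the
   order d of z = w^k.  If d is even, the factor 1 + z^(d/2) of
   N(j)(z) = \prod_(k < j) (1 + z^(k+1)) vanishes, as d <= n <= j.  If d is odd,
   every block of d consecutive factors has product 2 (evaluate 'X^d - 1 at -1),
   so N(j)(z) = 2^(j %/ d) * N(j %% d)(z), and N(j %% d)(z) is the sum of
   S^s_d(N(j %% d)) * z^s over s < d.  By Moebius inversion the sum of z^(s - i)
   over the z of order d is the Ramanujan sum c_d(i - s). *)

Require Import Defs.
From mathcomp Require Import all_boot all_order all_algebra.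
From mathcomp Require Import algC cyclotomic.

Set Implicit Arguments.
Unset Strict Implicit.
Unset Printing Implicit Defensive.

Import GRing.Theory Num.Theory.

Local Open Scope ring_scope.

(** * Divisor sums of the Moebius function *)

Lemma moebius_mul_prime (p m : nat) :
  prime p -> (0 < m)%N -> ~~ (p %| m)%N -> moebius (p * m) = - moebius m.
Proof.
move=> pr_p m_gt0 pNm; have p_gt0 := prime_gt0 pr_p.
have pm : perm_eq (primes (p * m)) (p :: primes m).
  apply: uniq_perm; rewrite /= ?primes_uniq ?mem_primes ?(negPf pNm) ?andbF //.
  by move=> q; rewrite primesM // primes_prime // !inE.
rewrite /moebius (perm_has _ pm) (perm_size pm) /=.
rewrite expnS expn1 dvdn_pmul2l // (negPf pNm) /=.
have -> : has (fun q => q ^ 2 %| p * m)%N (primes m)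
        = has (fun q => q ^ 2 %| m)%N (primes m).
  apply: eq_in_has => q; rewrite mem_primes => /and3P[pr_q _ qm] /=.
  rewrite Gauss_dvdr // coprimeXl // prime_coprime // dvdn_prime2 //.
  by apply: contra pNm => /eqP <-.
by case: ifP => _; rewrite ?oppr0 // exprS mulN1r.
Qed.

Lemma moebius_mul_dvd_prime (p m : nat) :
  prime p -> (0 < m)%N -> (p %| m)%N -> moebius (p * m) = 0.
Proof.
move=> pr_p m_gt0 pm; have p_gt0 := prime_gt0 pr_p.
rewrite /moebius ifT //; apply/hasP; exists p.
  by rewrite mem_primes pr_p muln_gt0 p_gt0 m_gt0 dvdn_mulr.
by rewrite expnS expn1 dvdn_pmul2l.
Qed.

Lemma sum_moebius (n : nat) :
  (0 < n)%N -> \sum_(e <- divisors n) moebius e = (n == 1)%N%:R.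
Proof.
move=> n_gt0; have [-> | n_neq1] := eqVneq n 1%N.
  by rewrite big_seq1.
have pr_p : prime (pdiv n) by rewrite pdiv_prime // ltn_neqAle eq_sym n_neq1.
have /dvdnP[m] := pdiv_dvd n; move: (pdiv n) pr_p => p pr_p def_n.
have p_gt0 := prime_gt0 pr_p.
move: n_gt0 {n_neq1}; rewrite {}def_n mulnC muln_gt0 p_gt0 /= => m_gt0.
have pm_gt0 : (0 < p * m)%N by rewrite muln_gt0 p_gt0.
rewrite (bigID (dvdn p)) /= -[X in X + _]big_filter -[X in _ + X]big_filter.
(* On the multiples of p, moebius (p * e) is 0 or - moebius e according as p
   divides e or not; the latter terms cancel those of the non-multiples of p. *)
have eq_mul : perm_eq [seq e <- divisors (p * m) | (p %| e)%N]
                      [seq (p * e)%N | e <- divisors m].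
  apply: uniq_perm; first by rewrite filter_uniq ?divisors_uniq.
    rewrite map_inj_uniq ?divisors_uniq // => a b /eqP.
    by rewrite eqn_pmul2l // => /eqP.
  move=> e; rewrite mem_filter -dvdn_divisors //.
  apply/andP/mapP => [[/dvdnP[c ->]] | [c]].
    rewrite mulnC dvdn_pmul2l // => cm.
    by exists c; rewrite -?dvdn_divisors.
  by rewrite -dvdn_divisors // => cm ->; rewrite dvdn_mulr // dvdn_pmul2l.
have eq_ndiv : perm_eq [seq e <- divisors (p * m) | ~~ (p %| e)%N]
                       [seq e <- divisors m | ~~ (p %| e)%N].
  apply: uniq_perm; rewrite ?filter_uniq ?divisors_uniq // => e.
  rewrite !mem_filter -!dvdn_divisors //.
  case: (boolP (p %| e)%N) => //= pNe.
  by rewrite Gauss_dvdr // coprime_sym prime_coprime.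
rewrite (perm_big _ eq_mul) (perm_big _ eq_ndiv) big_map big_filter /=.
rewrite (bigID (dvdn p)) /= big_seq_cond big1 => [|e]; last first.
  case/andP; rewrite -dvdn_divisors // => em pe.
  by rewrite moebius_mul_dvd_prime // (dvdn_gt0 m_gt0).
rewrite add0r big_seq_cond [X in _ + X]big_seq_cond -big_split big1 //=.
move=> e /andP[]; rewrite -dvdn_divisors // => em pNe.
by rewrite moebius_mul_prime ?addNr // (dvdn_gt0 m_gt0).
Qed.

(** If [o] divides [n], the map sending [e] to [n %/ e] carries the range of summation onto the
    divisors of [n %/ o], and [sum_moebius] applies; otherwise the sum is empty. With [o] the order
    of a root of unity, this is the sieve that isolates the roots of exact order [n]. *)
Lemma sum_moebius_codivisor (o n : nat) : (0 < n)%N ->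
  \sum_(e <- divisors n | (o %| e)%N) moebius (n %/ e) = (o == n)%:R.
Proof.
move=> n_gt0; have [on | oNn] := boolP (o %| n)%N; last first.
  rewrite big_seq_cond big1 => [|e]; last first.
    case/andP; rewrite -dvdn_divisors // => en oe.
    by rewrite (dvdn_trans oe en) in oNn.
  by case: eqP oNn => // ->; rewrite dvdnn.
have o_gt0 := dvdn_gt0 n_gt0 on.
have no_gt0 : (0 < n %/ o)%N by rewrite divn_gt0 // dvdn_leq.
have eq_div : perm_eq [seq (n %/ e)%N | e <- divisors n & (o %| e)%N]
                      (divisors (n %/ o)).
  apply: uniq_perm; last 1 first.
  - move=> c; rewrite -dvdn_divisors //.
    apply/mapP/idP => [[e] | cno].
      rewrite mem_filter -dvdn_divisors // => /andP[oe en] ->.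
      by rewrite dvdn_divRL // -{2}(divnK en) dvdn_mul.
    have cn : (c %| n)%N := dvdn_trans cno (dvdn_div on).
    exists (n %/ c)%N; last by rewrite divnA ?mulKn.
    rewrite mem_filter -dvdn_divisors // dvdn_div // andbT.
    by rewrite dvdn_divRL // mulnC -dvdn_divRL.
  - rewrite map_inj_in_uniq ?filter_uniq ?divisors_uniq // => a b.
    rewrite !mem_filter -!dvdn_divisors // => /andP[_ an] /andP[_ bn] eq_ab.
    have na_gt0 : (0 < n %/ a)%N := dvdn_gt0 n_gt0 (dvdn_div an).
    by apply/eqP; rewrite -(eqn_pmul2l na_gt0) {2}eq_ab !divnK.
  - exact: divisors_uniq.
rewrite -big_filter -(big_map _ xpredT moebius) (perm_big _ eq_div).
rewrite sum_moebius //.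
by rewrite -(eqn_pmul2r o_gt0) divnK // mul1n eq_sym.
Qed.

Lemma ramanujan_sumN (d : nat) (l : int) :
  ramanujan_sum d (- l) = ramanujan_sum d l.
Proof. by apply: eq_bigl => e; rewrite rpredN. Qed.

(** * Power sums over roots of unity *)

Section RootsOfUnity.

Variable F : fieldType.

Lemma prim_root_neq0 (n : nat) (w : F) : n.-primitive_root w -> w != 0.
Proof.
move=> prim_w; apply/eqP => w0; move: (prim_expr_order prim_w).
rewrite w0 expr0n gtn_eqF ?(prim_order_gt0 prim_w) // => /esym/eqP.
by rewrite oner_eq0.
Qed.

Lemma prim_order_dvdz (n : nat) (w : F) (l : int) :
  n.-primitive_root w -> (n%:Z %| l)%Z = (w ^ l == 1).
Proof.
move=> prim_w; case: l => m.
  by rewrite -exprnP -(prim_order_dvd prim_w) /dvdz.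
by rewrite NegzE rpredN -exprnN invr_eq1 -(prim_order_dvd prim_w) /dvdz.
Qed.

(** A geometric series of ratio [w ^ l]: unless the ratio is 1, the sum vanishes because
    [(w ^ l) ^+ n = 1]. *)
Lemma sum_prim_root_exprz (n : nat) (w : F) (l : int) : n.-primitive_root w ->
  \sum_(k < n) (w ^+ k) ^ l = if (n%:Z %| l)%Z then n%:R else 0.
Proof.
move=> prim_w; rewrite (prim_order_dvdz l prim_w).
rewrite (eq_bigr (fun k : 'I_n => (w ^ l) ^+ k)) => [|k _]; last first.
  by rewrite !exprnP exprzAC.
have [-> | wl_neq1] := eqVneq (w ^ l) 1.
  by under eq_bigr do rewrite expr1n; rewrite sumr_const card_ord.
have /esym/eqP := subrX1 (w ^ l) n.
rewrite [in X in _ == X]exprnP exprzAC -[w ^ n]exprnP (prim_expr_order prim_w).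
by rewrite exp1rz subrr mulf_eq0 subr_eq0 (negPf wl_neq1) => /eqP.
Qed.

(** Since [n %/ gcdn k n] is the order of [w ^+ k], the sum runs over the [e]-th roots of unity.
    These are the powers of [w ^+ q] with [q = n / e], which reduces the claim to the full power sum
    for [w ^+ q]. *)
Lemma sum_prim_root_dvd (n e : nat) (w : F) (l : int) :
  n.-primitive_root w -> (e %| n)%N ->
  \sum_(k < n | (n %/ gcdn k n %| e)%N) (w ^+ k) ^ l
    = if (e%:Z %| l)%Z then e%:R else 0.
Proof.
move=> prim_w en; have n_gt0 := prim_order_gt0 prim_w.
have e_gt0 := dvdn_gt0 n_gt0 en.
have /dvdnP[q def_n] := en.
have q_gt0 : (0 < q)%N by move: n_gt0; rewrite def_n muln_gt0 => /andP[].
have prim_wq : e.-primitive_root (w ^+ q).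
  have := exp_prim_root prim_w q.
  by rewrite {1 2}def_n gcdnMr mulKn.
rewrite -(sum_prim_root_exprz l prim_wq).
(* The order of [w ^+ k] divides [e] iff [w ^+ (k * e) = 1], that is, iff [n = q * e] divides
   [k * e]. *)
rewrite (eq_bigl (fun k : 'I_n => (q %| k)%N)) => [|k]; last first.
  rewrite (prim_order_dvd (exp_prim_root prim_w k)) -exprM.
  by rewrite -(prim_order_dvd prim_w) {1}def_n dvdn_pmul2r.
rewrite -(big_mkord (fun k => (q %| k)%N) (fun k => (w ^+ k) ^ l)).
rewrite -(big_mkord xpredT (fun k => ((w ^+ q) ^+ k) ^ l)).
under [RHS]eq_bigr do rewrite -exprM.
rewrite -(big_map (muln q) xpredT (fun k => (w ^+ k) ^ l)) -big_filter.
apply: perm_big; apply: uniq_perm.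
- by rewrite filter_uniq ?iota_uniq.
- rewrite map_inj_uniq ?iota_uniq // => a b /eqP.
  by rewrite eqn_pmul2l // => /eqP.
move=> k; rewrite mem_filter mem_index_iota /=.
apply/andP/mapP => [[/dvdnP[c ->]] | [c]].
  rewrite def_n mulnC ltn_pmul2l // => c_lt.
  by exists c; rewrite ?mem_index_iota.
rewrite mem_index_iota /= => c_lt ->.
by rewrite dvdn_mulr // def_n ltn_pmul2l.
Qed.

(** Each term [e] with [e] dividing [l] is a power sum over the [e]-th roots of unity. After
    exchanging the sums, a root of order [o] has as weight the sum of [moebius (d %/ e)] over the
    multiples [e] of [o] dividing [d], which is 1 if [o = d] and 0 otherwise. *)
Lemma ramanujan_sum_prim_root (n d : nat) (w : F) (l : int) :
  n.-primitive_root w -> (d %| n)%N ->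
  (ramanujan_sum d l)%:~R = \sum_(k < n | (n %/ gcdn k n == d)%N) (w ^+ k) ^ l.
Proof.
move=> prim_w dn; have n_gt0 := prim_order_gt0 prim_w.
have d_gt0 := dvdn_gt0 n_gt0 dn.
transitivity (\sum_(e <- divisors d) (moebius (d %/ e))%:~R *
    \sum_(k < n | (n %/ gcdn k n %| e)%N) (w ^+ k) ^ l).
  rewrite /ramanujan_sum rmorph_sum big_mkcond !big_seq; apply: eq_bigr => e.
  rewrite -dvdn_divisors // => ed.
  rewrite (sum_prim_root_dvd _ prim_w (dvdn_trans ed dn)).
  by case: ifP => _; rewrite ?mulr0 // rmorphM.
under eq_bigr do rewrite big_mkcond big_distrr /=.
rewrite exchange_big [RHS]big_mkcond /=; apply: eq_bigr => k _.
transitivity ((\sum_(e <- divisors d | (n %/ gcdn k n %| e)%N)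
    moebius (d %/ e))%:~R * (w ^+ k) ^ l).
  rewrite rmorph_sum big_distrl [RHS]big_mkcond /=; apply: eq_bigr => e _.
  by case: ifP; rewrite ?mulr0.
by rewrite sum_moebius_codivisor //; case: eqP; rewrite ?mul1r ?mul0r.
Qed.

(** * Values of integer polynomials at roots of unity *)

Lemma horner_map_intr (f : {poly int}) (z : F) :
  (map_poly intr f).[z] = \sum_(t < size f) (f`_t)%:~R * z ^+ t.
Proof.
rewrite (@horner_coef_wide _ (size f)) ?size_poly //.
by apply: eq_bigr => t _; rewrite coef_map.
Qed.

Lemma coef_sum_mod_prim_root (n : nat) (w : F) (i : int) (f : {poly int}) :
  n.-primitive_root w ->
  n%:R * (coef_sum_mod n i f)%:~R =
    \sum_(k < n) (map_poly intr f).[w ^+ k] * (w ^+ k) ^ (- i).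
Proof.
move=> prim_w; have w_neq0 := prim_root_neq0 prim_w.
transitivity (\sum_(t < size f) (f`_t)%:~R *
    \sum_(k < n) (w ^+ k) ^ (t%:Z - i)).
  rewrite rmorph_sum big_distrr big_mkcond /=; apply: eq_bigr => t _.
  rewrite (sum_prim_root_exprz _ prim_w) eqz_mod_dvd.
  by case: ifP; rewrite ?mulr0 // mulrC.
under eq_bigr do rewrite big_distrr /=.
rewrite exchange_big /=; apply: eq_bigr => k _.
rewrite horner_map_intr big_distrl /=; apply: eq_bigr => t _.
by rewrite -mulrA expfzDr // expf_neq0.
Qed.

Lemma horner_coef_sum_mod (d : nat) (z : F) (f : {poly int}) :
  (0 < d)%N -> z ^+ d = 1 ->
  (map_poly intr f).[z] = \sum_(s < d) (coef_sum_mod d s f)%:~R * z ^+ s.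
Proof.
move=> d_gt0 zd; rewrite horner_map_intr.
transitivity (\sum_(s < d) \sum_(t < size f)
    if (t%:Z == s%:Z %[mod d])%Z then (f`_t)%:~R * z ^+ s else 0); last first.
  by apply: eq_bigr => s _; rewrite rmorph_sum big_distrl [RHS]big_mkcond.
rewrite exchange_big /=; apply: eq_bigr => t _.
(* The only residue [s < d] congruent to [t] is [t %% d], and [z ^+ t] depends only on it. *)
rewrite -big_mkcond (big_pred1 (Ordinal (ltn_pmod t d_gt0))) => [|s] /=.
  by rewrite expr_mod.
by rewrite !modz_nat (modn_small (ltn_ord s)) eqz_nat eq_sym.
Qed.

(** * Values of N(m) at roots of unity *)

Lemma horner_subset_sum_poly (m : nat) (z : F) :
  (map_poly intr (subset_sum_poly m)).[z] = \prod_(k < m) (1 + z ^+ k.+1).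
Proof.
have -> : subset_sum_poly m = \prod_(k < m) ('X^(k.+1) + 1).
  (* Expanding the product, [A] is the set of indices at which the power of ['X] is chosen rather
     than 1. *)
  rewrite bigA_distr; apply: eq_bigr => A _.
  by rewrite -prodrXr big_mkcond.
rewrite rmorph_prod horner_prod; apply: eq_bigr => k _.
by rewrite rmorphD rmorph1 /= map_polyXn !hornerE addrC.
Qed.

Lemma prod_1Dprim_root (d : nat) (z : F) : odd d -> d.-primitive_root z ->
  \prod_(k < d) (1 + z ^+ k.+1) = 2.
Proof.
move=> odd_d prim_z; have zd := prim_expr_order prim_z.
have d_gt0 := prim_order_gt0 prim_z.
have := congr1 (horner^~ (-1)) (factor_Xn_sub_1 prim_z).
rewrite /= !hornerE horner_prod -signr_odd odd_d expr1 => prodN.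
(* The exponents 1, ..., d become 0, ..., d - 1, since [z ^+ d] and [z ^+ 0] are both 1. *)
have -> : \prod_(k < d) (1 + z ^+ k.+1) = \prod_(0 <= k < d) (1 + z ^+ k).
  case: (d) d_gt0 zd => // c _ zc.
  by rewrite big_nat_recl // big_mkord big_ord_recr /= zc expr0 mulrC.
have -> : \prod_(0 <= k < d) (1 + z ^+ k)
        = (-1) ^+ d * \prod_(0 <= k < d) ('X - (z ^+ k)%:P).[-1].
  rewrite -{2}(subn0 d) -prodr_const_nat -big_split /=.
  by apply: eq_bigr => k _; rewrite !hornerE mulN1r opprB opprK addrC.
by rewrite prodN -signr_odd odd_d mulN1r opprB opprK.
Qed.

Lemma horner_subset_sum_poly_odd (d j : nat) (z : F) :
  odd d -> d.-primitive_root z ->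
  (map_poly intr (subset_sum_poly j)).[z] =
    2 ^+ (j %/ d) * (map_poly intr (subset_sum_poly (j %% d))).[z].
Proof.
move=> odd_d prim_z; rewrite !horner_subset_sum_poly.
move: (j %/ d)%N (j %% d)%N (divn_eq j d) => q r ->.
elim: q => [|q IHq]; first by rewrite mul0n mul1r.
(* The first [d] factors give 2; in the others, the shift of the exponent by [d] is harmless. *)
rewrite mulSn -addnA big_split_ord /= prod_1Dprim_root // exprS -mulrA -IHq.
congr (_ * _); apply: eq_bigr => k _.
by rewrite -addnS exprD (prim_expr_order prim_z) mul1r.
Qed.

Lemma horner_subset_sum_poly_even (d j : nat) (z : F) :
  ~~ odd d -> d.-primitive_root z -> (d <= j)%N ->
  (map_poly intr (subset_sum_poly j)).[z] = 0.
Proof.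
move=> even_d prim_z le_dj; have d_gt0 := prim_order_gt0 prim_z.
have def_d : d = d./2.*2 by rewrite even_halfK.
have h_gt0 : (0 < d./2)%N by rewrite half_gt0; case: (d) d_gt0 even_d => [|[]].
have h_lt : (d./2 < d)%N by rewrite {2}def_d -addnn -ltn_psubLR // subnn.
(* The square of [z ^+ d./2] is 1, but it is not 1 itself, as [d] does not divide the smaller
   positive [d./2]. *)
have zh : z ^+ d./2 = -1.
  have : (z ^+ d./2) ^+ 2 == 1.
    by rewrite -exprM muln2 -def_d (prim_expr_order prim_z).
  rewrite sqrf_eq1 -(prim_order_dvd prim_z) => /orP[|/eqP //].
  by move/(dvdn_leq h_gt0); rewrite leqNgt h_lt.
(* The index [d./2.-1] stands for the element d/2, whose factor is [1 + z ^+ d./2]. *)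
have hj : (d./2.-1 < j)%N by rewrite prednK // ltnW // (leq_trans h_lt).
rewrite horner_subset_sum_poly (bigD1 (Ordinal hj)) //=.
by rewrite prednK // zh subrr mul0r.
Qed.

(** * The formula, first over a field with a primitive root, then over the rationals *)

Lemma coef_sum_mod_subset_sum_poly (n j : nat) (w : F) (i : int) :
  n.-primitive_root w -> (n <= j)%N ->
  n%:R * (coef_sum_mod n i (subset_sum_poly j))%:~R =
    \sum_(d <- divisors n | odd d)
      2 ^+ (j %/ d) *
      \sum_(s < d)
        (coef_sum_mod d s (subset_sum_poly (j %% d)))%:~R *
        (ramanujan_sum d (i - s%:Z))%:~R
  :> F.
Proof.
move=> prim_w le_nj; have n_gt0 := prim_order_gt0 prim_w.
rewrite (coef_sum_mod_prim_root _ _ prim_w).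
transitivity (\sum_(d <- divisors n) \sum_(k < n | (n %/ gcdn k n == d)%N)
    (map_poly intr (subset_sum_poly j)).[w ^+ k] * (w ^+ k) ^ (- i)).
  under [RHS]eq_bigr do rewrite big_mkcond.
  rewrite exchange_big /=; apply: eq_bigr => k _.
  (* Each [k] is counted once: the order of [w ^+ k] is exactly one of the divisors of [n]. *)
  rewrite -big_mkcond -big_filter.
  have -> : [seq d <- divisors n | (n %/ gcdn k n == d)%N]
          = [:: (n %/ gcdn k n)%N].
    rewrite -(@filter_pred1_uniq _ (divisors n)) ?divisors_uniq //.
      by apply: eq_filter => d; rewrite /= eq_sym.
    by rewrite -dvdn_divisors // dvdn_div // dvdn_gcdr.
  by rewrite big_seq1.
rewrite [RHS]big_mkcond !big_seq; apply: eq_bigr => d.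
rewrite -dvdn_divisors // => dn; have d_gt0 := dvdn_gt0 n_gt0 dn.
case: ifPn => [odd_d | even_d]; last first.
  apply: big1 => k /eqP def_d; have := exp_prim_root prim_w k.
  rewrite def_d => prim_k.
  rewrite (horner_subset_sum_poly_even even_d prim_k) ?mul0r //.
  by rewrite (leq_trans (dvdn_leq _ dn)).
transitivity (\sum_(k < n | (n %/ gcdn k n == d)%N) \sum_(s < d) 2 ^+ (j %/ d) *
    ((coef_sum_mod d s (subset_sum_poly (j %% d)))%:~R *
      (w ^+ k) ^ (s%:Z - i))).
  apply: eq_bigr => k /eqP def_d; have := exp_prim_root prim_w k.
  rewrite def_d => prim_k.
  rewrite (horner_subset_sum_poly_odd _ odd_d prim_k).
  rewrite (horner_coef_sum_mod _ d_gt0 (prim_expr_order prim_k)).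
  rewrite big_distrr big_distrl /=; apply: eq_bigr => s _.
  by rewrite -!mulrA expfzDr ?(prim_root_neq0 prim_k).
rewrite exchange_big big_distrr /=; apply: eq_bigr => s _.
(* The exponents here are [s - i]; evenness of the Ramanujan sum in its argument corrects the
   sign. *)
rewrite -ramanujan_sumN opprB (ramanujan_sum_prim_root _ prim_w dn).
by rewrite !big_distrr.
Qed.

End RootsOfUnity.

Theorem theorem4p5 (n j : nat) (i : int) :
  (0 < n)%N -> (n <= j)%N ->
  (coef_sum_mod n i (subset_sum_poly j))%:~R =
    1 / n%:R *
    \sum_(d <- divisors n | odd d)
      2 ^+ (j %/ d) *
      \sum_(s < d)
        (coef_sum_mod d s (subset_sum_poly (j %% d)))%:~R *
        (ramanujan_sum d (i - s%:Z))%:~R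
  :> rat.
Proof.
move=> n_gt0 le_nj; have [w prim_w] := C_prim_root_exists n_gt0.
have n_neq0 : n%:R != 0 :> rat by rewrite pnatr_eq0 -lt0n.
apply: (mulfI n_neq0); rewrite mulrA mul1r divff // mul1r.
(* The primitive root [w] lives in [algC], so the rational identity is checked there through the
   injective [ratr]. *)
apply: (fmorph_inj (ratr : rat -> algC)).
rewrite rmorphM rmorph_nat /= ratr_int.
rewrite (coef_sum_mod_subset_sum_poly _ prim_w le_nj).
rewrite rmorph_sum; apply: eq_bigr => d _.
rewrite rmorphM rmorphXn rmorph_nat rmorph_sum; congr (_ * _).
by apply: eq_bigr => s _; rewrite rmorphM /= !ratr_int.
Qed.
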